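(* Let $m\in\mathbb N$, let $\mu:V_m\to\mathbb C\setminus\{0\}$ be a weight, and let $B$ be the backward shift of the lattice graph $G_m$, assumed bounded on $X=\ell^p(V_m,\mu)$, $1\le p<\infty$, or on $X=c_0(V_m,\mu)$. For every nonempty finite set $E\subseteq V_m$ and every $\varepsilon>0$, define $$\mathcal A(E,\varepsilon)=\bigcap_{v_{i,j}\in E}\left\{n\in\mathbb N: n^{m-i}|\mu_{i,j+n}|<\varepsilon\right\}.$$ Let $\mathcal F$ be a Furstenberg family on $\mathbb N_0$. Then the following assertions are equivalent: (i) $B$ is $\widetilde{\mathcal F}$-transitive; (ii) $B$ is $\mathcal F$-transitive; (iii) $\mathcal A(E,\varepsilon)\in\mathcal F$ for every nonempty finite set $E\subseteq V_m$ and every $\varepsilon>0$. Suppose, in addition, that $A\in\mathcal F$ implies $A\cap[N,\infty)\in\mathcal F$ for every $N\in\mathbb N$. Then the preceding assertions are also equivalent to (iv) $B$ is topologically $\mathcal F$-recurrent.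
   Context: $\mathbb N=\{1,2,\dots\}$, $\mathbb N_0=\{0,1,2,\dots\}$. Lattice graph: $G_m=(V_m,E_m)$ is the directed graph with vertex set $V_m=\{v_{i,j}:1\le i\le m,\ j\in\mathbb N\}$ and edges $v_{i,j}\to v_{i,j+1}$ ($1\le i\le m$, $j\in\mathbb N$) and $v_{i,j}\to v_{i+1,j}$ ($1\le i<m$, $j\in\mathbb N$). For a vertex $v$, $\operatorname{Chi}(v)=\{u:(v,u)\text{ is an edge}\}$ is its set of children. The backward shift is $(Bf)(v)=\sum_{u\in\operatorname{Chi}(v)}f(u)$ for functions $f:V_m\to\mathbb C$. Weighted spaces: put $\mu_{i,j}=\mu(v_{i,j})$. $\ell^p(V_m,\mu)$ is the space of $f:V_m\to\mathbb C$ with $\|f\|=\left(\sum_{v_{i,j}\in V_m}|\mu_{i,j}f(v_{i,j})|^p\right)^{1/p}<\infty$; $c_0(V_m,\mu)$ is the space of $f:V_m\to\mathbb C$ such that $\{v_{i,j}:|\mu_{i,j}f(v_{i,j})|\ge\delta\}$ is finite for every $\delta>0$, with norm $\sup_{v_{i,j}}|\mu_{i,j}f(v_{i,j})|$. Furstenberg families: a nonempty collection $\mathcal F$ of subsets of $\mathbb N_0$ is a Furstenberg family if every member of $\mathcal F$ is infinite and $A\in\mathcal F$, $A\subseteq C\subseteq\mathbb N_0$ imply $C\in\mathcal F$. The enlarged family $\widetilde{\mathcal F}$ consists of all $A\subseteq\mathbb N_0$ such that for every $N\in\mathbb N_0$ there is $D\in\mathcal F$ with $(D+\{-N,-N+1,\dots,N\})\cap\mathbb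 N_0\subseteq A$; it is again a Furstenberg family. For a bounded linear operator $T$ on $X$ and nonempty open $U,V\subseteq X$, $N_T(U,V)=\{n\in\mathbb N_0:T^n(U)\cap V\ne\varnothing\}$. $T$ is $\mathcal F$-transitive if $N_T(U,V)\in\mathcal F$ for all nonempty open $U,V\subseteq X$ (and similarly for $\widetilde{\mathcal F}$); $T$ is topologically $\mathcal F$-recurrent if $N_T(U,U)\in\mathcal F$ for every nonempty open $U\subseteq X$. *)

(* Defs.v *)
From mathcomp Require Import all_boot all_order all_algebra.
From mathcomp Require Import complex.
From mathcomp Require Import boolp classical_sets functions cardinality fsbigop.
From mathcomp Require Import reals ereal esum exp.

Set Implicit Arguments.
Unset Strict Implicit.
Unset Printing Implicit Defensive.
Import Order.TTheory GRing.Theory Num.Theory.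
Local Open Scope classical_set_scope.
Local Open Scope ring_scope.

(* The pair (i, j) encodes the vertex v_{i+1,j+1} of G_m; [row] and [col]
   recover the usual indices, 1 <= row v <= m and 1 <= col v. *)
Notation vertex m := ('I_m * nat)%type.

Definition row m (v : vertex m) : nat := v.1.+1.
Definition col m (v : vertex m) : nat := v.2.+1.

Definition edge m (v u : vertex m) : Prop :=
  (row u = row v /\ col u = (col v).+1) \/
  (row u = (row v).+1 /\ col u = col v).

Definition children m (v : vertex m) : set (vertex m) := [set u | edge v u].

(* v_{i,j} |-> v_{i,j+n} *)
Definition right_by m (n : nat) (v : vertex m) : vertex m := (v.1, (v.2 + n)%N).

Section Lattice.
Context {R : realType} {m : nat}.
Local Notation C := R[i].

(* The modulus of a complex number as an element of R. *)
Definition cabs (z : C) : R := ComplexField.Normc.normc z.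

Definition backward_shift (f : vertex m -> C) : vertex m -> C :=
  fun v => \sum_(u \in children v) f u.

(* A normed space of functions on the vertices: the subset [carrier] of all
   functions together with its norm (irrelevant outside of [carrier]). *)
Record function_space := FunctionSpace {
  carrier : set (vertex m -> C);
  fnorm : (vertex m -> C) -> R }.

Definition ell_enorm (p : R) (mu f : vertex m -> C) : \bar R :=
  ((\esum_(v in [set: vertex m]) ((cabs (mu v * f v)) `^ p)%:E) `^ p^-1)%E.

Definition ell (p : R) (mu : vertex m -> C) : function_space :=
  {| carrier := [set f | (ell_enorm p mu f < +oo)%E];
     fnorm := fun f => fine (ell_enorm p mu f) |}.

Definition c_zero (mu : vertex m -> C) : function_space :=
  {| carrier := [set f | forall delta : R, 0 < delta ->
                   finite_set [set v | delta <= cabs (mu v * f v)]];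
     fnorm := fun f => sup [set cabs (mu v * f v) | v in [set: vertex m]] |}.

Implicit Types (X : function_space) (T : (vertex m -> C) -> (vertex m -> C)).
Implicit Types (U W : set (vertex m -> C)) (F : set (set nat)).

Definition bounded_on X T : Prop :=
  (forall f, carrier X f -> carrier X (T f)) /\
  exists M : R, forall f, carrier X f -> fnorm X (T f) <= M * fnorm X f.

Definition open_in X U : Prop :=
  U `<=` carrier X /\
  forall f, U f -> exists2 r : R, 0 < r &
    forall g, carrier X g -> fnorm X (g \- f) < r -> U g.

Definition return_set T U W : set nat :=
  [set n | (iter n T @` U) `&` W !=set0].

Definition F_transitive X T F : Prop :=
  forall U W, open_in X U -> open_in X W -> U !=set0 -> W !=set0 ->
    F (return_set T U W).

Definition F_recurrent X T F : Prop :=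
  forall U, open_in X U -> U !=set0 -> F (return_set T U U).

Definition A_set (mu : vertex m -> C) (E : set (vertex m)) (eps : R) : set nat :=
  \bigcap_(v in E)
    [set n | (0 < n)%N /\ (n ^ (m - row v))%:R * cabs (mu (right_by n v)) < eps].

End Lattice.

Arguments function_space : clear implicits.

Definition furstenberg_family (F : set (set nat)) : Prop :=
  [/\ F !=set0,
      forall A, F A -> infinite_set A &
      forall A D, F A -> A `<=` D -> F D].

Definition enlarged (F : set (set nat)) : set (set nat) :=
  [set A | forall N : nat, exists2 D, F D &
    [set n : nat | exists2 d, D d &
       exists2 k : int, - N%:Z <= k <= N%:Z & n%:Z = d%:Z + k] `<=` A].

(* Main.v *)
(* Write B = S + D, where S moves along a row and D to the next row, and let T
   be the right inverse of S that inserts a zero column.  Then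
   T^n (1 + T D)^(-n) is a right inverse of B^n; the l-th coefficient of
   (1 + T D)^(-n), for l < m, is up to sign binomial(n + l - 1, l), of exact
   order n^l; and away from the first columns the right inverse is also a left
   inverse.  Hence the size of a solution h of B^n h = g, for g finitely
   supported, is governed at row i by n^(m - i) |mu_(i, j + n)|.  If these
   quantities are small, f + h is close to f while B^n (f + h) = g for n large
   and f finitely supported, which gives transitivity.  Conversely, if B^n f is
   close to the indicator g of an initial piece of the last row, then
   |f(v_(i, J + n))| is at least a multiple of n^(m - i), so f can be close to
   0, or to g, only if n belongs to A(E, eps).  Boundedness of B gives
   |mu_(i, j)| <= M |mu_(i, j + 1)|, which reduces all finite sets E to single
   columns and makes the sets A(E, eps) robust under bounded shifts of n. *)
Require Import Defs.
From mathcomp Require Import all_boot all_order all_algebra.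
From mathcomp Require Import complex.
From mathcomp Require Import boolp classical_sets functions cardinality fsbigop.
From mathcomp Require Import reals ereal esum exp.
From mathcomp Require Import zify ring lra.
Import Order.TTheory GRing.Theory Num.Theory.
Local Open Scope classical_set_scope.
Local Open Scope ring_scope.

Set Implicit Arguments.
Unset Strict Implicit.
Unset Printing Implicit Defensive.

(** * The modulus of complex numbers *)

Section Modulus.
Context {R : realType}.
Implicit Types z w : R[i].

Lemma cabsM z w : cabs (z * w) = cabs z * cabs w.
Proof. exact: ComplexField.Normc.normcM. Qed.

Lemma cabs_normE z : (cabs z)%:C%C = `|z|.
Proof. by []. Qed.

Lemma cabsD z w : cabs (z + w) <= cabs z + cabs w.
Proof. exact: le_normcD. Qed.

Lemma cabsN z : cabs (- z) = cabs z.
Proof. exact: normcN. Qed.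

Lemma cabsB z w : cabs (z - w) <= cabs z + cabs w.
Proof. by rewrite -(cabsN w) cabsD. Qed.

Lemma cabs0 : cabs (0 : R[i]) = 0.
Proof. exact: ComplexField.Normc.normc0. Qed.

Lemma cabs1 : cabs (1 : R[i]) = 1.
Proof. exact: ComplexField.Normc.normc1. Qed.

Lemma cabs_ge0 z : 0 <= cabs z.
Proof. by rewrite -lecR cabs_normE normr_ge0. Qed.

Lemma cabs_gt0 z : z != 0 -> 0 < cabs z.
Proof. by move=> z0; rewrite -ltcR cabs_normE normr_gt0. Qed.

Lemma cabs_nat n : cabs (n%:R : R[i]) = n%:R.
Proof.
by rewrite [LHS](normcMn 1) -[ComplexField.Normc.normc _]/(cabs 1) cabs1.
Qed.

Lemma cabs_signM n z : cabs ((-1) ^+ n * z) = cabs z.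
Proof.
by rewrite -signr_odd cabsM; case: (odd n); rewrite ?cabsN cabs1 mul1r.
Qed.

Lemma cabs_sum (I : Type) (s : seq I) (P : pred I) (f : I -> R[i]) :
  cabs (\sum_(i <- s | P i) f i) <= \sum_(i <- s | P i) cabs (f i).
Proof.
elim/big_ind2: _ => [|x a y b xa yb|//]; first by rewrite cabs0.
exact: (le_trans (cabsD _ _) (lerD xa yb)).
Qed.

End Modulus.

(** * Coefficients of the binomial series with exponent [- n] *)

Section Coefficients.
Local Open Scope nat_scope.

(** ['C((n + l).-1, l)] is the absolute value of the binomial coefficient of [- n] over [l]; this
    recurrence in [l] drives the inductions for both power bounds. *)
Lemma mul_bin_neg n l :
  l.+1 * 'C(n + l, l.+1) = (n + l) * 'C((n + l).-1, l).
Proof. by case: n l => [|n] [|l] //; rewrite mul_bin_diag ?addn0 ?addSn. Qed.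

Lemma bin_neg_le_exp n l : 0 < n -> 'C((n + l).-1, l) <= n ^ l.
Proof.
move=> n0; elim: l => [|l IH]; first by rewrite bin0.
rewrite addnS -pred_Sn -(leq_pmul2l (ltn0Sn l)) mul_bin_neg expnS.

rewrite mulnA leq_mul//; nia.
Qed.

Lemma exp_le_bin_neg n l : n ^ l <= l`! * 'C((n + l).-1, l).
Proof.
elim: l => [|l IH]; first by rewrite bin0.
rewrite addnS -pred_Sn factS mulnAC mul_bin_neg -mulnA expnS.
by rewrite leq_mul ?leq_addr// mulnC.
Qed.

Lemma bin_neg_le n l k : 0 < n -> l <= k ->
  'C((n + l).-1, l) <= 'C((n + k).-1, k).
Proof.
move=> n0; elim: k => [|k IH]; first by rewrite leqn0 => /eqP->.
rewrite leq_eqVlt ltnS => /predU1P[->//|/IH]; move/leq_trans; apply.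
by case: n n0 {IH} => // n _; rewrite !addSn /= addnS binS leq_addl.
Qed.

End Coefficients.

(** * Iterates of the shift and their right inverse *)

Section Iterates.
Context {R : realType} {m : nat}.
Local Notation C := R[i].
Local Notation B := (@backward_shift R m).
Implicit Types (f g : vertex m -> C) (v : vertex m).

(* Rows are indexed from 0, and [f] is continued by 0 to the rows [i >= m]; the
   backward shift then acts by the same formula on all rows. *)
Definition pad f (i j : nat) : C :=
  oapp (fun i' : 'I_m => f (i', j)) 0 (insub i).

Lemma padE f (i : 'I_m) j : pad f i j = f (i, j).
Proof. by rewrite /pad valK. Qed.

Lemma pad_lt f i j (im : (i < m)%N) : pad f i j = f (Ordinal im, j).
Proof. exact: padE (Ordinal im) j. Qed.

Lemma pad_out f i j : (m <= i)%N -> pad f i j = 0.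
Proof. by move=> im; rewrite /pad insubN// -leqNgt. Qed.

Lemma eq_pad f g : (forall i j, (i < m)%N -> pad f i j = pad g i j) -> f = g.
Proof. by move=> fg; apply/funext => -[i j]; rewrite -!padE fg. Qed.

Lemma pad_backward f i j : (i < m)%N ->
  pad (B f) i j = pad f i j.+1 + pad f i.+1 j.
Proof.
move=> im; rewrite !(pad_lt _ _ im) /backward_shift; set i' := Ordinal im.
have childP k l : children (i', j) (k, l) <->
    (k = i' /\ l = j.+1) \/ (k = i.+1 :> nat /\ l = j).
  rewrite /children /edge /row /col /=; split.
    by case=> -[] [kE] [lE]; [left; split => //; exact: val_inj|right].
  by case=> -[kE lE]; [left|right]; split; congr S; rewrite ?kE ?lE.
have [i1m|mi1] := ltnP i.+1 m.
  have -> : children (i', j) = (i', j.+1) |` [set (Ordinal i1m, j)].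
    apply/seteqP; split => -[k l]; rewrite childP.
      by case=> -[kE ->]; [left; rewrite kE|right; congr pair; exact: val_inj].
    by case=> -[-> ->]; [left|right].
  rewrite fsbigU0; [|exact: finite_set1|exact: finite_set1|]; last first.
    by move=> u [/= -> /(congr1 snd)/= /eqP]; rewrite gtn_eqF.
  by rewrite !fsbig_set1 -(padE f (Ordinal i1m)).
have -> : children (i', j) = [set (i', j.+1)].
  apply/seteqP; split => -[k l]; rewrite childP.
    by move=> [[-> ->]//|[ki _]]; move: (ltn_ord k); rewrite ki ltnNge mi1.
  by case=> -> ->; left.
by rewrite fsbig_set1 pad_out// addr0.
Qed.

Lemma backwardD f g : B (f \+ g) = B f \+ B g.
Proof.
have padD a b i j : pad (a \+ b) i j = pad a i j + pad b i j.
  by rewrite /pad; case: insub => //=; rewrite addr0.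
by apply: eq_pad => i j im; rewrite padD !pad_backward// !padD addrACA.
Qed.

Lemma iter_backwardD n f g : iter n B (f \+ g) = iter n B f \+ iter n B g.
Proof. by elim: n => //= n ->; exact: backwardD. Qed.

(** The value of [B f] at a vertex reads [f] only on the next antidiagonal, so [n] steps carry a
    support below antidiagonal [s] off the grid. *)
Lemma iter_backward_eq0 n f s : (s <= n)%N ->
  (forall v, (s <= v.1 + v.2)%N -> f v = 0) -> iter n B f = fun=> 0.
Proof.
move=> sn f0; suff H k : forall i j, (i < m)%N -> (s <= i + j + k)%N ->
    pad (iter k B f) i j = 0.
  apply: eq_pad => i j im; rewrite H// 1?(leq_trans sn) ?leq_addl//.
  by rewrite /pad; case: insub.
elim: k => [|k IH] i j im; rewrite ?addn0 => sij.
  by rewrite (pad_lt _ _ im) /= f0.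
rewrite pad_backward// IH//; last by rewrite addnS addSnnS.
have [i1m|mi1] := ltnP i.+1 m; last by rewrite pad_out// addr0.
by rewrite IH// ?addr0//; lia.
Qed.

(** Solve [f (i, j.+1) = B f (i, j) - f (i.+1, j)] upwards from the zero row [m]. The offset [m]
    keeps the columns involved positive. *)
Lemma backward_determined s f g :
  (forall v, (m + s <= v.1 + v.2)%N -> B f v = B g v) ->
  forall v, (m + s.+1 <= v.1 + v.2)%N -> f v = g v.
Proof.
move=> fg; suff H d : forall i j, (m - i <= d)%N -> (m + s.+1 <= i + j)%N ->
    pad f i j = pad g i j.
  by case=> i j /= ij; rewrite -!padE (H m)// leq_subr.
elim: d => [|d IH] i j; first by rewrite leqn0 subn_eq0 => mi; rewrite !pad_out.
move=> md sij; have [mi|im] := leqP m i; first by rewrite !pad_out.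
case: j sij => [|j] sij; first lia.
apply: (@addIr _ (pad f i.+1 j)); rewrite [in RHS]IH; [|lia|lia].
rewrite -!pad_backward// !(pad_lt _ _ im) fg//=; lia.
Qed.

Lemma iter_backward_determined n f g : iter n B f = iter n B g ->
  forall v, (m + n <= v.1 + v.2)%N -> f v = g v.
Proof.
elim: n f g => [|n IH] f g; first by move=> /= ->.
by rewrite !iterSr => /IH; exact: backward_determined.
Qed.

(* Writing [B = S + D] with [S], [D] the two commuting coordinate shifts, this
   is [T ^ n (1 + T D) ^ (- n) g], where [T] is the right inverse of [S] that
   inserts a zero column. *)
Definition lift n g (v : vertex m) : C :=
  \sum_(l < m) if (n + l <= v.2)%N
    then (-1) ^+ l * ('C((n + l).-1, l)%:R * pad g (v.1 + l) (v.2 - (n + l)))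
    else 0.

(** Terms reaching below the last row vanish, so the length of the sum is free; this lets sums for
    neighbouring rows be matched term by term. *)
Lemma pad_lift n g i j K : (i < m)%N -> (m <= i + K)%N -> pad (lift n g) i j =
  \sum_(l < K) if (n + l <= j)%N
    then (-1) ^+ l * ('C((n + l).-1, l)%:R * pad g (i + l) (j - (n + l)))
    else 0.
Proof.
move=> im mK; rewrite (pad_lt _ _ im) /lift /=.
pose F l := if (n + l <= j)%N
    then (-1) ^+ l * ('C((n + l).-1, l)%:R * pad g (i + l) (j - (n + l)))
    else 0.
have F0 l : (m <= i + l)%N -> F l = 0.
  by move=> il; rewrite /F pad_out// !mulr0 if_same.
rewrite -[LHS](big_mkord xpredT F) -[RHS](big_mkord xpredT F).
have big0 L L' : (m <= i + L)%N -> (L <= L')%N ->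
    \sum_(0 <= l < L') F l = \sum_(0 <= l < L) F l.
  move=> mL LL'; rewrite (@big_cat_nat _ _ _ L)//= [X in _ + X]big_nat_cond.
  rewrite [X in _ + X]big1 ?addr0// => l /andP[/andP[Ll _] _].
  by apply: F0; lia.
have [/big0->//|/ltnW/big0->//] := leqP K m; lia.
Qed.

Lemma lift0 g : lift 0 g = g.
Proof.
apply: eq_pad => i j im; rewrite (@pad_lift _ _ _ _ m.+1)//; last lia.
rewrite big_ord_recl /= !addn0 subn0 !mul1r big1 ?addr0// => l _.
by rewrite !add0n /= bin_small// mul0r mulr0 if_same.
Qed.

(** Since [S T = 1] and [T], [D] commute, [B T^(n+1) = T^n (1 + T D)], which cancels one factor of
    the inverse power. On coefficients this is Pascal's rule. *)
Lemma backward_lift n g : B (lift n.+1 g) = lift n g.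
Proof.
apply: eq_pad => i j im; rewrite pad_backward//.
rewrite (@pad_lift n g i j m.+1)//; last lia.
rewrite (@pad_lift n.+1 g i j.+1 m.+1)//; last lia.
have -> : pad (lift n.+1 g) i.+1 j = \sum_(l < m) if (n.+1 + l <= j)%N
    then (-1) ^+ l * ('C((n.+1 + l).-1, l)%:R
      * pad g (i.+1 + l) (j - (n.+1 + l))) else 0.
  have [i1m|mi1] := ltnP i.+1 m; first by rewrite (@pad_lift _ _ _ _ m)//; lia.
  rewrite pad_out// big1// => l _; rewrite pad_out ?mulr0 ?if_same//; lia.
(* Splitting off the terms of index 0 aligns index [l.+1] in row [i] with index [l] in row
   [i.+1]. *)
rewrite !big_ord_recl /= -addrA; congr (_ + _).
  by rewrite !addn0 subSS !bin0 ltnS.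
rewrite -big_split; apply: eq_bigr => l _ /=.
rewrite /bump /= !add1n !addSn !addnS ltnS subSS /=.
case: ifP => _; last by rewrite addr0.
by rewrite binS natrD exprS; ring.
Qed.

Lemma iter_backward_lift n g : iter n B (lift n g) = g.
Proof. by elim: n => [|n IH]; rewrite ?lift0// iterSr backward_lift. Qed.

(** Both sides have the same image under [B^n], which determines them this far to the right. *)
Lemma lift_iter_backward n f v : (m + n <= v.1 + v.2)%N ->
  lift n (iter n B f) v = f v.
Proof.
by move: v; apply: iter_backward_determined; rewrite iter_backward_lift.
Qed.

End Iterates.

Section Spaces.
Context {R : realType} {m : nat}.
Implicit Types (f g mu : vertex m -> R[i]) (v : vertex m) (s : seq (vertex m)).

Definition supported f s := forall v, v \notin s -> f v = 0.

(* The features of the weighted spaces that the theorem depends on; the triangle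
   inequality for the norm is not among them. *)
Record sequence_space (X : function_space R m) mu : Prop := SequenceSpace {
  carrierB : forall f g, carrier X f -> carrier X g -> carrier X (f \- g);
  coord_le_fnorm : forall f v, carrier X f -> cabs (mu v * f v) <= fnorm X f;
  supported_carrier : forall f s, supported f s -> carrier X f;
  supported_fnorm : forall f s d, supported f s -> 0 <= d ->
    (forall v, cabs (mu v * f v) <= d) -> fnorm X f <= (size s)%:R * d;
  dense_supported : forall f r, carrier X f -> 0 < r ->
    exists g s, supported g s /\ fnorm X (g \- f) < r }.

Definition truncate s f : vertex m -> R[i] :=
  fun v => if v \in s then f v else 0.

Lemma truncate_supported s f : supported (truncate s f) s.
Proof. by move=> v /negbTE vs; rewrite /truncate vs. Qed.

Lemma truncate_sub s f v : v \notin s -> truncate s f v - f v = - f v.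
Proof. by move=> /negbTE vs; rewrite /truncate vs sub0r. Qed.

Lemma truncate_sub_in s f v : v \in s -> truncate s f v - f v = 0.
Proof. by move=> vs; rewrite /truncate vs subrr. Qed.

(** * The weighted [l^p] spaces *)

Section Ell.
Context (p : R) (mu : vertex m -> R[i]).
Context (p1 : 1 <= p).

Let p0 : 0 < p. Proof. exact: lt_le_trans p1. Qed.

Let a f v : \bar R := ((cabs (mu v * f v)) `^ p)%:E.
Let S f : \bar R := \esum_(v in [set: vertex m]) a f v.

Let a_ge0 f v : (0 <= a f v)%E. Proof. by rewrite lee_fin powR_ge0. Qed.

Let S_ge0 f : (0 <= S f)%E. Proof. exact: esum_ge0. Qed.

Let carrierE f : carrier (ell p mu) f <-> (S f < +oo)%E.
Proof.
split; first by apply: lty_poweRy; rewrite invr_eq0 gt_eqF.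
exact: poweR_lty.
Qed.

Let S_fin f : carrier (ell p mu) f -> S f = (fine (S f))%:E.
Proof. by move=> /carrierE Sf; rewrite fineK// ge0_fin_numE. Qed.

Let fnormE f : fnorm (ell p mu) f = fine (S f) `^ p^-1.
Proof. exact: fine_poweR. Qed.

Let powRK x : 0 <= x -> (x `^ p) `^ p^-1 = x.
Proof. by move=> x0; rewrite -powRrM divff ?gt_eqF// powRr1. Qed.

Let S_supported f s : (forall v, v \notin s -> mu v * f v = 0) ->
  S f = (\sum_(v <- undup s) a f v)%E.
Proof.
move=> fs; rewrite /S (esumID [set` undup s])//.
rewrite [X in (_ + X)%E]esum1 ?adde0; last first.
  move=> v [_ /= /negP]; rewrite mem_undup => vs.
  by rewrite /a fs// cabs0 powR0 ?gt_eqF.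
rewrite setTI esum_fset//; last exact: finite_seq.
by rewrite [RHS]fsbig_seq// undup_uniq.
Qed.

Let ell_carrierB f g : carrier (ell p mu) f -> carrier (ell p mu) g ->
  carrier (ell p mu) (f \- g).
Proof.
move=> /carrierE Sf /carrierE Sg; apply/carrierE.
(* From [x + y <= 2 max(x, y)], the p-th power of the sum is at most [2^p (x^p + y^p)]. Rounding
   [2^p] up to an integer turns this into a finite sum of copies, which commutes with [esum]. *)
pose N := (Num.truncn (2 `^ p)).+1.
have a_sub v : (a (f \- g)%R v <= \sum_(k < N) (a f v + a g v))%E.
  rewrite /a sumEFin lee_fin sumr_const card_ord.
  set x := cabs (mu v * f v); set y := cabs (mu v * g v).
  have xy0 : 0 <= x `^ p + y `^ p by rewrite addr_ge0// powR_ge0.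
  rewrite -[leRHS]mulr_natl (@le_trans _ _ (2 `^ p * (x `^ p + y `^ p)))//;
    last first.
    by rewrite ler_wpM2r// ltW// truncnS_gt.
  have x0 : 0 <= x by exact: cabs_ge0.
  have y0 : 0 <= y by exact: cabs_ge0.
  have fg_xy : cabs (mu v * (f v - g v)) <= x + y by rewrite mulrBr cabsB.
  rewrite (@le_trans _ _ ((2 * Num.max x y) `^ p))//.
    rewrite ge0_ler_powR ?nnegrE ?cabs_ge0 ?mulr_ge0 ?le_max ?x0 ?(ltW p0)//.
    by rewrite (le_trans fg_xy)// mulr_natl mulr2n lerD// le_max lexx ?orbT.
  rewrite powRM ?le_max ?x0// ler_wpM2l ?powR_ge0//.
  by rewrite /Num.max; case: ifP => _; rewrite ?lerDl ?lerDr powR_ge0.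
apply: le_lt_trans (le_esum _) _; first by move=> v _; exact: a_sub.
rewrite esum_sum; last by move=> v k _ _; rewrite adde_ge0.
apply: lte_sum_pinfty => k _; rewrite esumD// lte_add_pinfty//.
Qed.

Lemma ell_sequence_space : sequence_space (ell p mu) mu.
Proof.
split => [|f v Xf|f s fs|f s d fs d0 fd|f r Xf r0]; first exact: ell_carrierB.
- rewrite fnormE -[leLHS]powRK ?cabs_ge0//.
  have aS : cabs (mu v * f v) `^ p <= fine (S f).
    rewrite -lee_fin -S_fin//; apply: esum_ge; exists [set v]; last first.
      by rewrite fsbig_set1.
    by split => //; exact: finite_set1.
  by rewrite ge0_ler_powR ?nnegrE ?powR_ge0 ?invr_ge0 ?(ltW p0)// fine_ge0.
- apply/carrierE; rewrite (@S_supported _ s); last first.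
    by move=> v /fs->; rewrite mulr0.
  by apply: lte_sum_pinfty => v _; rewrite ltry.
- rewrite fnormE (@S_supported _ s); last by move=> v /fs->; rewrite mulr0.
  rewrite sumEFin /= (@le_trans _ _ (((size s)%:R * d `^ p) `^ p^-1))//.
    rewrite ge0_ler_powR ?nnegrE ?invr_ge0 ?(ltW p0)//.
    + by apply: sumr_ge0 => v _; rewrite powR_ge0.
    + by rewrite mulr_ge0 ?powR_ge0.
    apply: le_trans (_ : (size (undup s))%:R * d `^ p <= _); last first.
      by rewrite ler_wpM2r ?powR_ge0// ler_nat size_undup.
    rewrite mulr_natl -[leRHS]iter_addr_0 -count_predT -big_const_seq.
    apply: ler_sum => v _.
    by rewrite ge0_ler_powR ?nnegrE ?cabs_ge0 ?(ltW p0).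
  rewrite powRM ?powR_ge0// powRK// ler_wpM2r//.
  (* The power [1 / p <= 1] does not increase a size that is at least 1; the empty list is treated
     apart. *)
  have [->|s0] := posnP (size s); first by rewrite powR0// invr_eq0 gt_eqF.
  by rewrite ler1_powR ?ler1n// invf_le1.
- have Sf := S_fin Xf; have rp0 : 0 < r `^ p by rewrite powR_gt0.
  (* A finite partial sum within [r^p] of the total gives the truncation; the error is the tail of
     the series. *)
  have : (S f - (r `^ p)%:E < S f)%E by rewrite Sf lte_fin; lra.
  move=> /ereal_sup_gt[_ [A [finA _] <-]].
  have [s sA] := (finite_seqP A).1 finA; rewrite sA => sum_gt.
  exists (truncate s f), s; split; first exact: truncate_supported.
  rewrite fnormE -[ltRHS](powRK (ltW r0)).
  have -> : S (truncate s f \- f) = (\esum_(v in ~` [set` s]) a f v)%E.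
    rewrite /S [RHS]esum_mkcond; apply: eq_esum => v _; rewrite /a /=.
    have [vs|vs] := boolP (v \in s).
      rewrite truncate_sub_in// mulr0 cabs0 powR0 ?gt_eqF//.
      by rewrite ifF//; apply/negbTE; rewrite in_setC negbK inE.
    rewrite truncate_sub// mulrN cabsN ifT// in_setC; apply: contra vs.
    by rewrite inE.
  move: sum_gt Sf; rewrite /S (esumID [set` s])// setTI esum_fset// setTI.
  set x := (\sum_(v \in _) _)%E; set y := (\esum_(v in _) _)%E.
  have : (0 <= y)%E by exact: esum_ge0.
  have : (0 <= x)%E by exact: fsume_ge0.
  move: x y => [x| |] [y| |]//=; rewrite !(lee_fin, lte_fin).
  move=> x0 y0 xy _; rewrite gt0_ltr_powR ?nnegrE ?invr_gt0 ?powR_ge0//; lra.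
Qed.

End Ell.

(** * The weighted [c_0] space *)

Section CZero.
Context (mu : vertex m -> R[i]).
Context (m0 : (0 < m)%N).

Let values f := [set cabs (mu v * f v) | v in [set: vertex m]].

Let values_neq0 f : values f !=set0.
Proof.
pose v : vertex m := (Ordinal m0, 0%N).
by exists (cabs (mu v * f v)); exists v.
Qed.

Let values_ubound f : carrier (c_zero mu) f -> has_ubound (values f).
Proof.
move=> /(_ 1 ltr01)/finite_seqP[s sE].
(* Values off [s] are below 1, and each value on [s] is at most the sum. *)
exists (1 + \sum_(v <- s) cabs (mu v * f v)) => _ [v _ <-].
have sum0 (s' : seq (vertex m)) : 0 <= \sum_(v <- s') cabs (mu v * f v).
  by apply: sumr_ge0 => w _; exact: cabs_ge0.
have [vs|vs] := boolP (v \in s).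
  rewrite (perm_big _ (perm_to_rem vs)) big_cons /=.
  by have := sum0 (rem v s); lra.
have : ~ [set` s] v by exact/negP.
by rewrite -sE /= => /negP; rewrite -ltNge; have := sum0 s; lra.
Qed.

Lemma c_zero_sequence_space : sequence_space (c_zero mu) mu.
Proof.
split => [f g Xf Xg d d0|f v Xf|f s fs d d0|f s d fs d0 fd|f r Xf r0].
- have d2 : 0 < d / 2 by lra.
  have := conj (Xf _ d2) (Xg _ d2); rewrite -finite_setU.
  apply: sub_finite_set => v /=; rewrite mulrBr => dv.
  have := le_trans dv (cabsB _ _).
  have [|] := leP (d / 2) (cabs (mu v * f v)); first by left.
  by move=> fv fgv; right; lra.
- by apply: ub_le_sup; [exact: values_ubound|exists v].
- apply: sub_finite_set (finite_seq s) => v /=; apply: contraPT => /fs->.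
  by rewrite mulr0 cabs0 leNgt d0.
- apply: ge_sup (values_neq0 f) _ => _ [v _ <-].
  have [vs|/fs->] := boolP (v \in s); last by rewrite mulr0 cabs0 mulr_ge0.
  apply: le_trans (fd v) _; rewrite ler_peMl// ler1n.
  by case: s vs {fs}.
- have r2 : 0 < r / 2 by lra.
  have [s sE] := (finite_seqP _).1 (Xf _ r2).
  exists (truncate s f), s; split; first exact: truncate_supported.
  apply: (@le_lt_trans _ _ (r / 2)); last lra.
  apply: ge_sup (values_neq0 _) _ => _ [v _ <-] /=.
  have [vs|vs] := boolP (v \in s).
    by rewrite truncate_sub_in// mulr0 cabs0 ltW.
  rewrite truncate_sub// mulrN cabsN ltW// ltNge; apply/negP => rv.
  have : [set u | r / 2 <= cabs (mu u * f u)] v by [].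
  by rewrite sE /= (negbTE vs).
Qed.

End CZero.

End Spaces.

(** * Upper and lower bounds for the entries of the right inverse *)

Section LiftEstimates.
Context {R : realType} {m : nat}.
Implicit Types (f g : vertex m -> R[i]) (v : vertex m).

(** A term of index [l] survives only if [l] rows fit below [v], that is [l <= m - row v], and its
    coefficient is at most [n^l]. *)
Lemma cabs_lift_le n g K v : (0 < n)%N -> (forall u, cabs (g u) <= K) ->
  cabs (lift n g v) <= m%:R * K * (n ^ (m - Defs.row v))%:R.
Proof.
move=> n0 gK; have K0 : 0 <= K by apply: le_trans (gK v); exact: cabs_ge0.
apply: le_trans (cabs_sum _ _ _) _.
set b := (_ ^ _)%:R.
have -> : m%:R * K * b = \sum_(l < m) K * b.
  by rewrite sumr_const card_ord -[RHS]mulr_natl mulrA.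
apply: ler_sum => l _; case: ifP => _; last by rewrite cabs0 mulr_ge0.
rewrite cabs_signM cabsM cabs_nat mulrC.
have [vlm|vlm] := ltnP (v.1 + l) m; last first.
  by rewrite pad_out// cabs0 mul0r mulr_ge0.
rewrite (pad_lt _ _ vlm) ler_pM ?cabs_ge0// ler_nat.
apply: leq_trans (bin_neg_le_exp _ n0) _; apply: leq_pexp2l => //.
by rewrite /Defs.row; lia.
Qed.

Definition bottom_row J v : R[i] := ((v.1.+1 == m) && (v.2 <= J)%N)%:R.

(* The terms of index [l < k] of [lift n (bottom_row J)] vanish, and the one of
   index [k] has the largest coefficient, which is of order [n ^ k]. *)
Lemma exp_le_cabs_lift n J (i : 'I_m) g : (0 < n)%N -> (m <= J)%N ->
  (forall v, (v.2 <= J)%N -> cabs (g v - bottom_row J v) <= (2 * m%:R)^-1) ->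
  (n ^ (m - i.+1))%:R <= 2 * (m`!)%:R * cabs (lift n g (i, J + n)%N).
Proof.
move=> n0 mJ gJ; have im := ltn_ord i.
set k := (m - i.+1)%N; have kE : (i + k.+1 = m)%N by rewrite /k; lia.
pose c l : R := ('C((n + l).-1, l))%:R.
pose t g' l : R[i] := (-1) ^+ l *
  ('C((n + l).-1, l)%:R * pad g' (i + l) (J + n - (n + l))).
have liftE g' : lift n g' (i, J + n)%N = \sum_(l < k.+1) t g' l.
  rewrite -padE (@pad_lift _ _ _ _ _ _ k.+1) ?kE//.
  by apply: eq_bigr => l _; rewrite ifT//; have := ltn_ord l; lia.
have bottomE : lift n (bottom_row J) (i, J + n)%N =
    (-1) ^+ k * ('C((n + k).-1, k))%:R.
  have ilm l : (l <= k)%N -> (i + l < m)%N by lia.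
  rewrite liftE big_ord_recr big1 /= ?add0r /t => [|l _].
    rewrite (pad_lt _ _ (ilm _ (leqnn k))) /bottom_row /= -addnS kE eqxx.
    by rewrite (_ : (_ <= J)%N) ?mulr1//; lia.
  rewrite (pad_lt _ _ (ilm _ (ltnW (ltn_ord l)))) /bottom_row /=.
  rewrite (_ : _ == m = false) ?mulr0//.
  by apply/negbTE; have := ltn_ord l; lia.
(* There are [k.+1 <= m] terms, each perturbed by at most [c k / (2 m)], so at least half of the
   leading term [c k] remains. *)
have close : cabs (lift n g (i, J + n)%N - lift n (bottom_row J) (i, J + n)%N)
    <= c k / 2.
  rewrite !liftE -sumrB; apply: le_trans (cabs_sum _ _ _) _.
  have m_gt0 : 0 < m%:R :> R by rewrite ltr0n; lia.
  apply: (@le_trans _ _ (\sum_(l < k.+1) c k * (2 * m%:R)^-1)).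
    apply: ler_sum => l _; rewrite /t -!mulrBr cabs_signM cabsM cabs_nat.
    have lk : (l <= k)%N by rewrite -ltnS.
    have ilm : (i + l < m)%N by lia.
    rewrite !(pad_lt _ _ ilm) ler_pM ?cabs_ge0//.
      by rewrite ler_nat bin_neg_le.
    by apply: gJ => /=; lia.
  rewrite sumr_const card_ord -[leLHS]mulr_natl invfM.
  have km : k.+1%:R / m%:R <= 1 :> R.
    by rewrite ler_pdivrMr// mul1r ler_nat; lia.
  rewrite [leLHS](_ : _ = (k.+1%:R / m%:R) * (c k / 2)); last by ring.
  by rewrite ler_piMl// divr_ge0.
have : c k <= cabs (lift n g (i, J + n)%N) + c k / 2.
  have cE : cabs (lift n (bottom_row J) (i, J + n)%N) = c k.
    by rewrite bottomE cabs_signM cabs_nat.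
  rewrite -[leLHS]cE; move: close.
  set x := lift n g _; set y := lift n _ _ => close.
  by rewrite -[y in leLHS](subKr x) (le_trans (cabsB _ _))// lerD2l.
have : (n ^ k)%:R <= (m`!)%:R * c k.
  rewrite -natrM ler_nat; apply: leq_trans (exp_le_bin_neg n k) _.
  by rewrite leq_mul2r leq_fact ?orbT//; lia.
move=> nk ck; apply: le_trans nk _.
by rewrite mulrAC mulrC ler_wpM2r//; lra.
Qed.

End LiftEstimates.

(** * Small weights and return times *)

Section Transitivity.
Context {R : realType} {m : nat} (m0 : (0 < m)%N).
Context (mu : vertex m -> R[i]) (mu_neq0 : forall v, mu v != 0).
Context (X : function_space R m) (HX : sequence_space X mu).
Context (bddB : bounded_on X backward_shift).
Local Notation B := (@backward_shift R m).
Local Notation bottom := (@bottom_row R m).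
Implicit Types (f g : vertex m -> R[i]) (v : vertex m) (s : seq (vertex m)).
Implicit Types (U W : set (vertex m -> R[i])) (eps : R).

Definition column J : set (vertex m) := [set v | v.2 = J].

Lemma finite_column J : finite_set (column J).
Proof.
apply: (@sub_finite_set _ _ ((fun i : 'I_m => (i, J)) @` [set: 'I_m])).
  by move=> [i j] jJ; exists i => //; congr pair.
exact/finite_image/finite_finset.
Qed.

Lemma column_neq0 J : column J !=set0.
Proof. by exists (Ordinal m0, J). Qed.

Lemma A_columnP J eps n : A_set mu (column J) eps n <->
  (0 < n)%N /\
  forall i : 'I_m, (n ^ (m - i.+1))%:R * cabs (mu (i, J + n)%N) < eps.
Proof.
split=> [An|[n0 An]]; last first.
  by move=> [i j] jJ; have {jJ}-> : j = J by []; split; [|exact: An].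
split; first by have [] := An (Ordinal m0, J) erefl.
by move=> i; have [] := An (i, J) erefl.
Qed.

Lemma A_set_le E eps eps' : eps <= eps' -> A_set mu E eps `<=` A_set mu E eps'.
Proof. by move=> ee n An v /An[n0 ne]; split; [|exact: lt_le_trans ee]. Qed.

Lemma weight_lower_bound s :
  exists2 d, 0 < d & forall v, v \in s -> d <= cabs (mu v).
Proof.
elim: s => [|u s [d d0 ds]]; first by exists 1.
exists (Num.min d (cabs (mu u))); first by rewrite lt_min d0 cabs_gt0.
by move=> v; rewrite inE ge_min => /predU1P[->|/ds->//]; rewrite lexx orbT.
Qed.

Lemma weight_lower_bound_cols J :
  exists2 d, 0 < d & forall v, (v.2 <= J)%N -> d <= cabs (mu v).
Proof.
have [d d0 ds] :=
  weight_lower_bound [seq (i, j) | i <- enum 'I_m, j <- iota 0 J.+1].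
exists d => // -[i j] /= jJ; apply: ds; apply/allpairsP; exists (i, j).
by rewrite mem_enum mem_iota.
Qed.

Lemma cols_bounded s : exists J, forall v, v \in s -> (v.2 <= J)%N.
Proof.
exists (\max_(v <- s) v.2) => v vs.
by rewrite (perm_big _ (perm_to_rem vs)) big_cons leq_maxl.
Qed.

Lemma supported_bounded g s : supported g s ->
  exists K, forall v, cabs (g v) <= K.
Proof.
move=> gs; exists (\sum_(v <- s) cabs (g v)) => v.
have sum0 (s' : seq (vertex m)) : 0 <= \sum_(v <- s') cabs (g v).
  by apply: sumr_ge0 => w _; exact: cabs_ge0.
have [vs|/gs->] := boolP (v \in s); last by rewrite cabs0.
by rewrite (perm_big _ (perm_to_rem vs)) big_cons /= lerDl.
Qed.

(** Compare norms for the indicator [e] of [(i, j.+1)]: [B e] is 1 at [(i, j)], while the norm of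
    [e] is at most the weight at [(i, j.+1)]. Having [1 <= M] allows exponents to be enlarged
    later. *)
Lemma weight_growth : exists2 M, 1 <= M &
  forall i j k, cabs (mu (i, j)) <= M ^+ k * cabs (mu (i, j + k)%N).
Proof.
have [BX [M BM]] := bddB.
suff step i j : cabs (mu (i, j)) <= Num.max 1 M * cabs (mu (i, j.+1)).
  exists (Num.max 1 M); first by rewrite le_max lexx.
  move=> i j; elim=> [|k IH]; first by rewrite addn0 mul1r.
  rewrite exprSr -mulrA addnS (le_trans IH)// ler_wpM2l//.
  by rewrite exprn_ge0// le_max ler01.
pose e v : R[i] := (v == (i, j.+1))%:R.
have es : supported e [:: (i, j.+1)] by move=> v; rewrite inE /e => /negbTE->.
have Xe := supported_carrier HX es.
have Be1 : B e (i, j) = 1.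
  rewrite -padE pad_backward// padE /e eqxx -[RHS]addr0; congr (_ + _).
  rewrite /pad; case: insub => //= i'.
  by rewrite xpair_eqE (ltn_eqF (ltnSn j)) andbF.
have : cabs (mu (i, j)) <= fnorm X (B e).
  by have := coord_le_fnorm HX (i, j) (BX _ Xe); rewrite Be1 mulr1.
have eM : fnorm X e <= cabs (mu (i, j.+1)).
  have := supported_fnorm HX es (cabs_ge0 (mu (i, j.+1))).
  rewrite mul1r; apply=> v; rewrite /e; case: eqVneq => [->|_].
    by rewrite mulr1.
  by rewrite mulr0 cabs0 cabs_ge0.
have e0 : 0 <= fnorm X e.
  by apply: le_trans (coord_le_fnorm HX (i, j) Xe); exact: cabs_ge0.
move=> muB; apply: le_trans muB _; apply: le_trans (BM _ Xe) _.
apply: (@le_trans _ _ (Num.max 1 M * fnorm X e)).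
  by rewrite ler_wpM2r// le_max lexx orbT.
by rewrite ler_wpM2l// le_max ler01.
Qed.

(** The finitely many weights on the columns up to [J + N] are bounded away from 0 and the powers of
    [n] are at least 1, so a small [eps] rules out every [n < N]. *)
Lemma A_column_ge J N : exists2 eps, 0 < eps &
  forall n, A_set mu (column J) eps n -> (N <= n)%N.
Proof.
have [d d0 dJ] := weight_lower_bound_cols (J + N)%N.
exists d => // n /A_columnP[n0 /(_ (Ordinal m0))]; rewrite leqNgt.
apply: contraPN => nN; apply/negP; rewrite -leNgt.
apply: le_trans (dJ (Ordinal m0, J + n)%N _) _ => /=; first lia.
by rewrite ler_peMl ?cabs_ge0// ler1n expn_gt0 n0.
Qed.

(** Moving each vertex of [E] right to a common column costs at most the factor [M ^+ (J0 + J)],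
    absorbed in [eps']. *)
Lemma A_column_sub E eps J0 : finite_set E -> 0 < eps ->
  exists J eps', [/\ (J0 <= J)%N, 0 < eps' &
    A_set mu (column J) eps' `<=` A_set mu E eps].
Proof.
move=> /finite_seqP[s ->] eps0; have [J sJ] := cols_bounded s.
have [M M1 muM] := weight_growth.
have M0 k : 0 < M ^+ k by rewrite exprn_gt0//; lra.
exists (J0 + J)%N, (eps / M ^+ (J0 + J)); split.
- exact: leq_addr.
- by rewrite divr_gt0.
move=> n /A_columnP[n0 An] [i j] /= vs; split => //.
rewrite /right_by /Defs.row /=; set p := (_ ^ _)%:R.
have jJ := sJ _ vs; rewrite /= in jJ.
have := An i; rewrite ltr_pdivlMr//; apply: le_lt_trans.
have := muM i (j + n)%N (J0 + J - j)%N.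
rewrite (_ : (j + n + _)%N = (J0 + J + n)%N); last lia.
move=> /le_trans le_mu; rewrite -mulrA ler_wpM2l//; apply: le_mu.
by rewrite mulrC ler_wpM2l ?cabs_ge0// ler_weXn2l//; lia.
Qed.

Lemma A_column_shift J N eps : 0 < eps -> exists2 eps', 0 < eps' &
  forall d n, A_set mu (column (J + N)) eps' d ->
    (n <= d + N)%N -> (d <= n + N)%N -> A_set mu (column J) eps n.
Proof.
move=> eps0; have [M M1 muM] := weight_growth.
have [e1 e10 large] := A_column_ge (J + N) N.+1.
have M0 k : 0 < M ^+ k by rewrite exprn_gt0//; lra.
(* The first factor comes from [n <= d + N <= N.+1 * d], the second from the at most [2 N] columns
   between [J + n] and [J + N + d]. Requiring [N < d] keeps [n] positive. *)
pose Q : R := (N.+1 ^ m)%:R * M ^+ (N + N).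
have Q0 : 0 < Q by rewrite mulr_gt0// ltr0n expn_gt0.
exists (Num.min e1 (eps / Q)); first by rewrite lt_min e10 divr_gt0.
move=> d n Ad ndN dnN; have Nd : (N < d)%N.
  by apply: large; apply: A_set_le Ad; rewrite ge_min lexx.
have /A_columnP[d0 dQ] : A_set mu (column (J + N)) (eps / Q) d.
  by apply: A_set_le Ad; rewrite ge_min lexx orbT.
apply/A_columnP; split=> [|i]; first lia.
have := dQ i; rewrite ltr_pdivlMr//; apply: le_lt_trans.
have := muM i (J + n)%N (d + N - n)%N.
rewrite (_ : (J + n + _)%N = (J + N + d)%N); last lia.
set w := cabs _; set w' := cabs _ => ww'.
have w'0 : 0 <= w' by exact: cabs_ge0.
have nd : (n ^ (m - i.+1) <= N.+1 ^ m * d ^ (m - i.+1))%N.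
  apply: leq_trans (_ : (N.+1 * d) ^ (m - i.+1) <= _)%N.
    by case: (m - i.+1)%N => // e; rewrite leq_exp2r//; nia.
  by rewrite expnMn leq_mul2r leq_pexp2l ?orbT//; lia.
have ww : w <= M ^+ (N + N) * w'.
  by rewrite (le_trans ww')// ler_wpM2r// ler_weXn2l//; lia.
apply: le_trans (_ : (N.+1 ^ m * d ^ (m - i.+1))%:R * (M ^+ (N + N) * w') <= _).
  by rewrite ler_pM ?cabs_ge0// ler_nat.
by rewrite natrM /Q le_eqVlt; apply/orP; left; apply/eqP; ring.
Qed.

Lemma open_supported U : open_in X U -> U !=set0 ->
  exists g s, U g /\ supported g s.
Proof.
move=> [UX Uopen] [f Uf]; have [r r0 fU] := Uopen f Uf.
have [g [s [gs gf]]] := dense_supported HX (UX _ Uf) r0.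
exists g, s; split => //; apply: fU => //.
exact: supported_carrier HX _ _ gs.
Qed.

(** With finitely supported [f] in [U] and [g] in [W], the point [f + lift n g] stays in [U] and is
    mapped to [g] by [B^n]. *)
Lemma A_column_return U W :
  open_in X U -> open_in X W -> U !=set0 -> W !=set0 ->
  exists J eps, 0 < eps /\ A_set mu (column J) eps `<=` return_set B U W.
Proof.
move=> Uo Wo U0 W0; have [f [s [Uf fs]]] := open_supported Uo U0.
have [g [s' [Wg gs']]] := open_supported Wo W0.
have [r r0 fU] := Uo.2 f Uf.
have [J sJ] := cols_bounded (s ++ s').
have f0 v : (J < v.2)%N -> f v = 0.
  move=> Jv; apply: fs; apply: contraL Jv => vs.
  by rewrite -leqNgt sJ// mem_cat vs.
have g0 v : (J < v.2)%N -> g v = 0.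
  move=> Jv; apply: gs'; apply: contraL Jv => vs.
  by rewrite -leqNgt sJ// mem_cat vs orbT.
have [K gK] := supported_bounded gs'.
have K0 : 0 <= K by apply: le_trans (gK (Ordinal m0, 0%N)); exact: cabs_ge0.
have [M M1 muM] := weight_growth.
have M0 k : 0 <= M ^+ k by rewrite exprn_ge0//; lra.
(* For [n >= m + J] the iterate [B^n] annihilates [f]. *)
have [e1 e10 large] := A_column_ge (J + m) (m + J).
(* The number of vertices in the box [S] around the support of [lift n g], times the entry bound
   relative to [r / (Q + 1)]. As [Q] may be 0, the denominator is [Q + 1]. *)
pose Q : R := (m * (J + m).+1)%:R * (m%:R * K * M ^+ (J + m)).
have Q0 : 0 <= Q by rewrite !mulr_ge0.
have Q1 : 0 < Q + 1 by lra.
exists (J + m)%N, (Num.min e1 (r / (Q + 1))).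
split; first by rewrite lt_min e10 divr_gt0.
move=> n An; have nlarge : (m + J <= n)%N.
  by apply: large; apply: A_set_le An; rewrite ge_min lexx.
have /A_columnP[n0 muQ] : A_set mu (column (J + m)) (r / (Q + 1)) n.
  by apply: A_set_le An; rewrite ge_min lexx orbT.
pose S := [seq (i, j) | i <- enum 'I_m, j <- iota n (J + m).+1].
have lift_out v : ~~ (n <= v.2 <= J + m + n)%N -> lift n g v = 0.
  case: v => i j /= vn; rewrite /lift big1//= => l _.
  case: ifP => // nlj; have := ltn_ord l => lm.
  rewrite /pad; case: insub => [i1|]; rewrite /= ?g0 ?mulr0//=; lia.
have liftS : supported (lift n g) S.
  move=> [i j] ijS; apply: lift_out; apply: contra ijS => /= nj.
  apply/allpairsP; exists (i, j); rewrite mem_enum mem_iota; split => //=; lia.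
have lift_small v : cabs (mu v * lift n g v) <=
    m%:R * K * M ^+ (J + m) * (r / (Q + 1)).
  have rQ : 0 <= m%:R * K * M ^+ (J + m) * (r / (Q + 1)).
    by rewrite !mulr_ge0 ?invr_ge0 ?(ltW r0) ?(ltW Q1).
  have [nv|/lift_out->] := boolP (n <= v.2 <= J + m + n)%N; last first.
    by rewrite mulr0 cabs0.
  case: v nv => i j /= nj; rewrite cabsM.
  have := cabs_lift_le (i, j) n0 gK; rewrite /Defs.row /=.
  have := muQ i; have := muM i j (J + m + n - j)%N.
  rewrite subnKC; last lia.
  set w := cabs _; set w' := cabs _; set x := cabs _; set p := (_ ^ _)%:R.
  move=> ww' pw' xp; have w'0 : 0 <= w' by exact: cabs_ge0.
  have {}ww' : w <= M ^+ (J + m) * w'.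
    by rewrite (le_trans ww')// ler_wpM2r// ler_weXn2l//; lia.
  apply: le_trans (_ : M ^+ (J + m) * w' * (m%:R * K * p) <= _).
    by rewrite ler_pM ?cabs_ge0.
  rewrite [leLHS](_ : _ = m%:R * K * M ^+ (J + m) * (p * w')); last by ring.
  by rewrite ler_wpM2l ?mulr_ge0// ltW.
have hS : supported (f \+ lift n g) (s ++ S).
  move=> v; rewrite mem_cat negb_or => /andP[vs vS].
  by rewrite /= fs// liftS// addr0.
exists g; split => //; exists (f \+ lift n g); last first.
  rewrite iter_backwardD iter_backward_lift.
  rewrite (@iter_backward_eq0 _ _ _ _ (m + J))//.
    by apply/funext => v /=; rewrite add0r.
  by case=> i j /= ij; apply: f0 => /=; have := ltn_ord i; lia.
apply: fU; first exact: supported_carrier HX _ _ hS.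
have -> : f \+ lift n g \- f = lift n g.
  by apply/funext => v /=; rewrite addrC addKr.
apply: le_lt_trans (supported_fnorm HX liftS _ lift_small) _.
  by rewrite !mulr_ge0 ?invr_ge0 ?(ltW r0) ?(ltW Q1).
rewrite size_allpairs size_iota size_enum_ord mulrA -/Q mulrCA gtr_pMr//.
by rewrite ltr_pdivrMr// mul1r; lra.
Qed.

(** A ball for the weighted sup distance: its openness in [X] follows from the coordinate bound and
    the triangle inequality in the complex plane. The uniform [c < eps] supplies the margin. *)
Definition sup_ball g eps : set (vertex m -> R[i]) := [set f | carrier X f /\
  exists2 c, c < eps & forall v, cabs (mu v * (f v - g v)) <= c].

Lemma sup_ball_open g eps : open_in X (sup_ball g eps).
Proof.
split=> [f []//|f [Xf [c ceps fc]]].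
exists (eps - c) => [|h Xh hf]; first by rewrite subr_gt0.
split=> //; exists (fnorm X (h \- f) + c) => [|v]; first by lra.
have -> : mu v * (h v - g v) = mu v * (h v - f v) + mu v * (f v - g v).
  by rewrite -mulrDr addrA subrK.
apply: le_trans (cabsD _ _) _; apply: lerD => //.
exact: (coord_le_fnorm HX v (carrierB HX Xh Xf)).
Qed.

Lemma sup_ball_center g eps : carrier X g -> 0 < eps -> sup_ball g eps g.
Proof.
move=> Xg eps0; split => //; exists 0 => // v.
by rewrite subrr mulr0 cabs0.
Qed.

Lemma bottom_row_supported J : exists s, supported (bottom J) s.
Proof.
exists [seq (i, j) | i <- enum 'I_m, j <- iota 0 J.+1] => -[i j] ijJ.
rewrite /bottom_row /= andbC; case: leqP => // jJ; case/negP: ijJ.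
by apply/allpairsP; exists (i, j); rewrite mem_enum mem_iota.
Qed.

(** In column [J + n], where [h] vanishes, [f] is small, yet it is at least a multiple of
    [n^(m - row)] because [B^n f] is near [bottom J]. Transitivity uses [h = 0], recurrence
    [h = bottom J]. *)
Lemma return_A_column J eps : (m <= J)%N -> 0 < eps -> exists2 eta, 0 < eta &
  (forall h n, (forall v, (J < v.2)%N -> h v = 0) -> (0 < n)%N ->
     return_set B (sup_ball h eta) (sup_ball (bottom J) eta) n ->
     A_set mu (column J) eps n) /\
  ~ return_set B (sup_ball (fun=> 0) eta) (sup_ball (bottom J) eta) 0%N.
Proof.
move=> mJ eps0; have [d d0 dJ] := weight_lower_bound_cols J.
have m_gt0 : 0 < m%:R :> R by rewrite ltr0n.
have m_ge1 : 1 <= m%:R :> R by rewrite ler1n.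
have fact0 : 0 < 2 * (m`!)%:R :> R by rewrite mulr_gt0// ltr0n fact_gt0.
have m20 : 0 < 2 * m%:R :> R by rewrite mulr_gt0.
(* The first bound offsets the constant [2 m!] of the lower estimate; the second makes the error on
   columns up to [J] at most [1 / (2 m)]. *)
pose eta := Num.min (eps / (2 * (m`!)%:R)) (d / (2 * m%:R)).
have eta_eps : eta <= eps / (2 * (m`!)%:R) by rewrite ge_min lexx.
have eta_d : eta <= d / (2 * m%:R) by rewrite ge_min lexx orbT.
exists eta; first by rewrite lt_min !divr_gt0.
split=> [h n h0 n0 [_ [[f [Xf [c ceta fc]] <-] [_ [c' c'eta gc']]]]|].
  set G := iter n B f in gc'.
  have GJ v : (v.2 <= J)%N -> cabs (G v - bottom J v) <= (2 * m%:R)^-1.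
    move=> vJ; have muv := cabs_gt0 (mu_neq0 v).
    rewrite -(ler_pM2l muv) -cabsM (le_trans (gc' v))// ltW//.
    apply: lt_le_trans c'eta _; apply: le_trans eta_d _.
    by rewrite ler_wpM2r ?invr_ge0 ?(ltW m20)// dJ.
  apply/A_columnP; split => // i.
  have := exp_le_cabs_lift i n0 mJ GJ.
  rewrite lift_iter_backward; last by rewrite /=; lia.
  have := fc (i, J + n)%N; rewrite h0 /=; last lia.
  rewrite subr0 cabsM.
  have : 0 <= cabs (mu (i, J + n)%N) by exact: cabs_ge0.
  set w := cabs _; set x := cabs _; set p := (_ ^ _)%:R => w0 wx px.
  apply: le_lt_trans (_ : 2 * (m`!)%:R * (w * x) < _).
    by rewrite [leRHS](_ : _ = 2 * (m`!)%:R * x * w) ?ler_wpM2r//; ring.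
  rewrite mulrC -ltr_pdivlMr//; lra.
(* At time 0 the same [f] would be near both 0 and 1 at the first vertex of the last row, giving
   [d < 2 eta <= d]. *)
move=> [_ [[f [Xf [c ceta fc]] <-] [_ [c' c'eta gc']]]].
have lastm : (m.-1 < m)%N by rewrite prednK.
pose v : vertex m := (Ordinal lastm, 0%N).
have bv : bottom J v = 1 by rewrite /bottom_row /= prednK// eqxx.
have := dJ v (leq0n _); rewrite -[mu v]mulr1 -bv.
have -> : mu v * bottom J v =
    mu v * (f v - 0) - mu v * (f v - bottom J v) by rewrite subr0 -mulrBr subKr.
move=> dmu; have := le_trans dmu (cabsB _ _); have := fc v; have := gc' v.
have : d / (2 * m%:R) <= d / 2.
  by rewrite ler_wpM2l ?(ltW d0)// lef_pV2 ?posrE// ler_peMr.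
by rewrite /=; lra.
Qed.

(** * Furstenberg families and the implications between the assertions *)

Section Family.
Context (F : set (set nat)) (hF : furstenberg_family F).

Let F_up A D : F A -> A `<=` D -> F D. Proof. by have [_ _] := hF; exact. Qed.

Let A_sets_in_F := forall (E : set (vertex m)) eps,
  finite_set E -> E !=set0 -> 0 < eps -> F (A_set mu E eps).

Lemma enlarged_sub A : enlarged F A -> F A.
Proof.
move=> /(_ 0%N)[D FD DA]; apply: F_up FD _ => d Dd; apply: DA.
by exists d => //; exists 0; rewrite ?addr0.
Qed.

(** The set for column [J + N], thickened by [N], remains inside the set for column [J], hence
    inside the return set. *)
Lemma enlarged_transitive_of_A_sets :
  A_sets_in_F -> F_transitive X B (enlarged F).
Proof.
move=> FA U W Uo Wo U0 W0 N.
have [J [eps [eps0 JUW]]] := A_column_return Uo Wo U0 W0.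
have [eps' eps'0 shift] := A_column_shift J N eps0.
exists (A_set mu (column (J + N)) eps').
  by apply: FA => //; [exact: finite_column|exact: column_neq0].
move=> n [d Ad [k /andP[Nk kN] nE]]; apply: JUW.
by apply: shift Ad _ _; lia.
Qed.

Lemma A_sets_of_transitive : F_transitive X B F -> A_sets_in_F.
Proof.
move=> trB E eps Efin E0 eps0.
have [J [eps' [mJ eps'0 AE]]] := A_column_sub m Efin eps0.
have [eta eta0 [ret ret0]] := return_A_column mJ eps'0.
have [s bs] := bottom_row_supported J.
have X0 : carrier X (fun=> 0) by apply: (supported_carrier HX (s := [::])).
have Xb := supported_carrier HX bs.
apply: F_up (subset_trans _ AE).
  apply: (trB (sup_ball (fun=> 0) eta) (sup_ball (bottom J) eta)).
  - exact: sup_ball_open.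
  - exact: sup_ball_open.
  - by exists (fun=> 0); exact: sup_ball_center.
  - by exists (bottom J); exact: sup_ball_center.
move=> [/ret0//|n] retn; exact: ret retn.
Qed.

Lemma A_sets_of_recurrent :
  (forall A, F A -> forall N, (0 < N)%N -> F (A `&` [set n | (N <= n)%N])) ->
  F_recurrent X B F -> A_sets_in_F.
Proof.
move=> Ftail recB E eps Efin E0 eps0.
have [J [eps' [mJ eps'0 AE]]] := A_column_sub m Efin eps0.
have [eta eta0 [ret _]] := return_A_column mJ eps'0.
have [s bs] := bottom_row_supported J.
have Xb := supported_carrier HX bs.
have := recB _ (sup_ball_open (bottom J) eta)
  (ex_intro _ _ (sup_ball_center Xb eta0)).
(* Time 0 always returns but lies in no [A_set] of a nonempty set; cutting at 1 removes it. *)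
move=> /Ftail/(_ 1%N isT)/F_up; apply; apply: subset_trans AE.
move=> n [retn n0]; apply: ret retn => //.
by move=> v Jv; rewrite /bottom_row leqNgt Jv andbF.
Qed.

End Family.
End Transitivity.

Unset Implicit Arguments.

Theorem theorem3p1 (R : realType) (m : nat) (hm : (0 < m)%N)
    (mu : vertex m -> R[i]) (hmu : forall v, mu v != 0)
    (X : function_space R m)
    (hX : (exists2 p : R, 1 <= p & X = ell p mu) \/ X = c_zero mu)
    (hB : bounded_on X backward_shift)
    (F : set (set nat)) (hF : furstenberg_family F) :
  let i_ := F_transitive X backward_shift (enlarged F) in
  let ii_ := F_transitive X backward_shift F in
  let iii_ := forall (E : set (vertex m)) (eps : R),
    finite_set E -> E !=set0 -> 0 < eps -> F (A_set mu E eps) in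
  let iv_ := F_recurrent X backward_shift F in
  [/\ i_ <-> ii_,
      ii_ <-> iii_ &
      (forall A, F A -> forall N : nat, (0 < N)%N ->
         F (A `&` [set n | (N <= n)%N])) ->
      (iii_ <-> iv_)].
Proof.
move=> i_ ii_ iii_ iv_.
have HX : sequence_space X mu.
  case: hX => [[p p1 ->]|->]; first exact: ell_sequence_space.
  exact: c_zero_sequence_space.
have iii_i : iii_ -> i_ by exact: (enlarged_transitive_of_A_sets hm hmu HX hB).
have i_ii : i_ -> ii_.
  by move=> trB U W Uo Wo U0 W0; apply: (enlarged_sub hF); exact: trB.
have ii_iii : ii_ -> iii_ by exact: (A_sets_of_transitive hm hmu HX hB hF).
split; [by split; auto|by split; auto|move=> Ftail; split].
  by move=> /iii_i/i_ii trB U Uo U0; exact: trB.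
exact: (A_sets_of_recurrent hm hmu HX hB hF).
Qed.
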